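(* If Alice sends one half of the Bell state $|\Phi_1\rangle=\frac{1}{\sqrt2}(|00\rangle+|11\rangle)$ through any non-unital qubit channel $\Lambda_{nu}$, then the final shared state $(\mathbf I\otimes\Lambda_{nu})(|\Phi_1\rangle\langle\Phi_1|)$ is useful and universal for quantum teleportation if and only if $\Lambda_{nu}$ belongs to a strict subset of the non-unital qubit channels associated with rank-three and rank-four Choi states. That is, the set of non-unital qubit channels for which the final shared state is useful and universal is a strict subset of the set of non-unital qubit channels whose Choi state has rank three or rank four.
   Context: A qubit channel is a completely positive trace-preserving linear map $\Lambda$ on $2\times2$ complex matrices; it is unital if $\Lambda(\mathbf I_2)=\mathbf I_2$ and non-unital otherwise. The Choi state of $\Lambda$ is $(\mathbf I\otimes\Lambda)(|\Phi_1\rangle\langle\Phi_1|)$. If Alice prepares a two-qubit state $\rho$ and sends one half (the second qubit) to Bob through $\Lambda$, the final shared state is $(\mathbf I\otimes\Lambda)(\rho)$. Useful and universal for quantum teleportation. For a two-qubit density matrix $\rho$ let $T_\rho$ be the real $3\times3$ matrix with entries $T_{ij}=\mathrm{Tr}(\rho\,\sigma_i\otimes\sigma_j)$, where $\sigma_1,\sigma_2,\sigma_3$ are the Pauli matrices. By local unitaries $\rho$ can be brought to a canonical form $\rho_C$ whose correlation matrix is diagonal with entries $\lambda_k|t_{kk}|$, $\lambda_k\in\{-1,+1\}$, $k=1,2,3$; if $\det T_\rho\le0$ one can take $\lambda_k=-1$ for all $k$ with $|t_{kk}|\neq0$. The maximal average fidelity $F_\rho$ is the teleportation fidelity averaged over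 uniformly distributed pure qubit inputs in the standard teleportation protocol, maximized over local unitaries (the maximum is attained by $\rho_C$). The fidelity deviation $\Delta_\rho$ is the standard deviation of the fidelity over the inputs when $\rho_C$ is used. The state $\rho$ is useful if $F_\rho>\frac23$ and universal if $\Delta_\rho=0$. States with $F_\rho>\frac23$ satisfy $\det T_\rho<0$, and for states with $\det T_\rho<0$ one has $F_\rho=\frac12\bigl(1+\frac13\sum_i|t_{ii}|\bigr)$ and $\Delta_\rho=\frac{1}{3\sqrt{10}}\sqrt{\sum_{i<j}(|t_{ii}|-|t_{jj}|)^2}$, so that such a state is useful and universal exactly when $|t_{11}|=|t_{22}|=|t_{33}|>\frac13$. *)

(* Defs.v *)
From HB Require Import structures.
From mathcomp Require Import all_boot all_order all_algebra.
From mathcomp Require Import spectral.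
From mathcomp Require Import complex mxtens.
From mathcomp Require Import all_classical all_reals all_analysis.

Set Implicit Arguments.
Unset Strict Implicit.
Unset Printing Implicit Defensive.

Import Order.TTheory GRing.Theory Num.Theory.
Local Open Scope classical_set_scope.
Local Open Scope complex_scope.
Local Open Scope ring_scope.

Section LinearAlgebra.
Variable R : realType.
Local Notation C := R[i].

Definition adjmx m n (A : 'M[C]_(m, n)) : 'M[C]_(n, m) := map_mx Num.conj A^T.

(* The order of R[i] makes [0 <= z] mean that z is real and nonnegative, so
   self-adjointness is implied. *)
Definition psdmx n (A : 'M[C]_n) : Prop :=
  forall v : 'cV[C]_n, 0 <= (adjmx v *m A *m v) 0 0.

(* The (i, j) block of A in M_m (x) M_n = M_m(M_n): the first tensor factor
   indexes the blocks. *)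
Definition tblock m n (A : 'M[C]_(m * n)) (i j : 'I_m) : 'M[C]_n :=
  \matrix_(k, l) A (mxtens_index (i, k)) (mxtens_index (j, l)).

(* I_m (x) L *)
Definition id_tens m n p (L : 'M[C]_n -> 'M[C]_p) (A : 'M[C]_(m * n)) :
    'M[C]_(m * p) :=
  \sum_(i < m) \sum_(j < m) delta_mx i j *t L (tblock A i j).

Definition ptrace_left m n (A : 'M[C]_(m * n)) : 'M[C]_n :=
  \sum_(i < m) tblock A i i.

Definition mx2 (a b c d : C) : 'M[C]_2 :=
  \matrix_(i, j) if i == 0 then (if j == 0 then a else b)
                 else (if j == 0 then c else d).

(* pauli 0 is the identity; pauli 1, 2, 3 are sigma_1, sigma_2, sigma_3. *)
Definition pauli (k : 'I_4) : 'M[C]_2 :=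
  match val k with
  | 0%N => 1%:M
  | 1%N => mx2 0 1 1 0
  | 2%N => mx2 0 (- 'i) 'i 0
  | _ => mx2 1 0 0 (-1)
  end.

Definition sigma (i : 'I_3) : 'M[C]_2 := pauli (lift ord0 i).

Definition ket (i : 'I_2) : 'cV[C]_2 := delta_mx i 0.

Definition proj n (v : 'cV[C]_n) : 'M[C]_n := v *m adjmx v.

End LinearAlgebra.

Section Channels.
Variable R : realType.
Local Notation C := R[i].

Definition completely_positive (L : 'M[C]_2 -> 'M[C]_2) : Prop :=
  forall (m : nat) (A : 'M[C]_(m * 2)), psdmx A -> psdmx (id_tens L A).

Definition trace_preserving (L : 'M[C]_2 -> 'M[C]_2) : Prop :=
  forall A : 'M[C]_2, \tr (L A) = \tr A.

Definition qubit_channel (L : {linear 'M[C]_2 -> 'M[C]_2}) : Prop :=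
  completely_positive L /\ trace_preserving L.

Definition unital (L : {linear 'M[C]_2 -> 'M[C]_2}) : Prop := L 1%:M = 1%:M.

Definition nonunital_channel (L : {linear 'M[C]_2 -> 'M[C]_2}) : Prop :=
  qubit_channel L /\ ~ unital L.

(* (|00> + |11>) / sqrt 2 *)
Definition Phi1 : 'cV[C]_(2 * 2) :=
  (Num.sqrt 2)^-1%:C *: (ket R 0 *t ket R 0 + ket R 1 *t ket R 1).

(* This is also the state shared after sending the second half of Phi1
   through L. *)
Definition choi_state (L : {linear 'M[C]_2 -> 'M[C]_2}) : 'M[C]_(2 * 2) :=
  id_tens L (proj Phi1).

End Channels.

Section Teleportation.
Variable R : realType.
Local Notation C := R[i].

(* T_ij = Tr (rho (sigma_i (x) sigma_j)); the trace is real for Hermitian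
   rho. *)
Definition correlation_mx (rho : 'M[C]_(2 * 2)) : 'M[R]_3 :=
  \matrix_(i, j) complex.Re (\tr (rho *m (sigma R i *t sigma R j))).

Definition local_unitary (U V : 'M[C]_2) (rho : 'M[C]_(2 * 2)) :
    'M[C]_(2 * 2) :=
  (U *t V) *m rho *m adjmx (U *t V).

(* (|01> - |10>) / sqrt 2 *)
Definition singlet : 'cV[C]_(2 * 2) :=
  (Num.sqrt 2)^-1%:C *: (ket R 0 *t ket R 1 - ket R 1 *t ket R 0).

(* Up to phases, the four Bell states; bell 0 is the singlet. *)
Definition bell (k : 'I_4) : 'cV[C]_(2 * 2) :=
  (pauli R k *t (1%:M : 'M[C]_2)) *m singlet.

(* Bob's unnormalized state when qubits 1 and 2 of psi (x) rho are found in
   the Bell state number k; its trace is the probability of this outcome. *)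
Definition bob_state (rho : 'M[C]_(2 * 2)) (psi : 'cV[C]_2) (k : 'I_4) :
    'M[C]_2 :=
  let joint : 'M[C]_((2 * 2) * 2) :=
    castmx (mulnA 2 2 2, mulnA 2 2 2) (proj psi *t rho) in
  let Pk := proj (bell k) *t (1%:M : 'M[C]_2) in
  ptrace_left (Pk *m joint *m Pk).

(* Standard protocol, with the convention that the singlet teleports
   perfectly: on outcome k, Bob applies pauli k. *)
Definition teleport_output (rho : 'M[C]_(2 * 2)) (psi : 'cV[C]_2) : 'M[C]_2 :=
  \sum_(k < 4) pauli R k *m bob_state rho psi k *m adjmx (pauli R k).

Definition fidelity (rho : 'M[C]_(2 * 2)) (psi : 'cV[C]_2) : R :=
  complex.Re ((adjmx psi *m teleport_output rho psi *m psi) 0 0).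

Definition bloch_ket (theta phi : R) : 'cV[C]_2 :=
  (cos (theta / 2))%:C *: ket R 0 +
  ((cos phi +i* sin phi) * (sin (theta / 2))%:C) *: ket R 1.

(* Average over the uniform distribution on pure qubit states, that is the
   normalized area measure (4 pi)^-1 sin theta dtheta dphi of the Bloch
   sphere. *)
Definition qubit_avg (f : 'cV[C]_2 -> R) : R :=
  (4 * pi)^-1 *
  \int[lebesgue_measure]_(theta in `[0, pi])
    (sin theta *
     \int[lebesgue_measure]_(phi in `[0, 2 * pi]) f (bloch_ket theta phi)).

Definition avg_fidelity (rho : 'M[C]_(2 * 2)) : R := qubit_avg (fidelity rho).

Definition fidelity_stddev (rho : 'M[C]_(2 * 2)) : R :=
  Num.sqrt (qubit_avg (fun psi => (fidelity rho psi - avg_fidelity rho) ^+ 2)).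

Definition max_avg_fidelity (rho : 'M[C]_(2 * 2)) : R :=
  sup [set r | exists U V : 'M[C]_2,
    [/\ U \is unitarymx, V \is unitarymx &
        r = avg_fidelity (local_unitary U V rho)]].

(* The sign choice for which the singlet-based protocol is optimal: with d the
   determinant of the correlation matrix (invariant under local unitaries),
   all entries are nonpositive if d <= 0; otherwise two are negative and the
   one of least modulus is positive. *)
Definition canonical_signs (d : R) (T : 'M[R]_3) : Prop :=
  if d <= 0 then forall k, T k k <= 0
  else exists k, 0 < T k k /\
         forall j, j != k -> T j j < 0 /\ `|T k k| <= `|T j j|.

Definition canonical_form (rho rhoC : 'M[C]_(2 * 2)) : Prop :=
  [/\ exists U V : 'M[C]_2,
        [/\ U \is unitarymx, V \is unitarymx & rhoC = local_unitary U V rho],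
      is_diag_mx (correlation_mx rhoC) &
      canonical_signs (\det (correlation_mx rho)) (correlation_mx rhoC)].

(* A canonical form always exists, and it is unique up to permuting the
   diagonal of its correlation matrix and changing its local Bloch vectors,
   on which fidelity_stddev does not depend. *)
Definition has_fidelity_deviation (rho : 'M[C]_(2 * 2)) (delta : R) : Prop :=
  exists2 rhoC, canonical_form rho rhoC & delta = fidelity_stddev rhoC.

Definition useful (rho : 'M[C]_(2 * 2)) : Prop :=
  2 / 3 < max_avg_fidelity rho.

Definition universal (rho : 'M[C]_(2 * 2)) : Prop :=
  has_fidelity_deviation rho 0.

End Teleportation.

(* Main.v *)
(* The fidelity of the standard protocol on an input with Bloch vector n is
   (1 - sum_k n_k^2 T_kk) / 2, so a vanishing fidelity deviation makes the
   diagonal of T constant: the canonical form of a universal state has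
   T = tau I. If tau = 0, the state is uncorrelated on traceless observables,
   this persists under local unitaries, every average fidelity is 1/2 and the
   state is not useful. If tau <> 0, Alice's marginal of the Choi state being
   I/2, the vanishing of all 3x3 minors forces Bob's marginal to be I/2 as well,
   which makes the channel unital. Hence the rank is at least 3. Strictness is
   witnessed by a channel replacing its input by a fixed state. *)

Require Import Defs.
From HB Require Import structures.
From mathcomp Require Import all_boot all_order all_algebra.
From mathcomp Require Import spectral complex mxtens ring lra.
From mathcomp Require Import all_classical all_reals all_analysis.

Set Implicit Arguments.
Unset Strict Implicit.
Unset Printing Implicit Defensive.

Import Order.TTheory GRing.Theory Num.Theory.
Import numFieldNormedType.Exports.
Local Open Scope classical_set_scope.
Local Open Scope complex_scope.
Local Open Scope ring_scope.

(** * Vanishing of 3x3 minors in rank at most two *)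

Section Minors.

Lemma ord2P (i : 'I_2) : i = 0 \/ i = 1.
Proof. by case: i => -[|[|//]] lti; [left | right]; apply/val_inj. Qed.

Lemma ord3P (i : 'I_3) : [\/ i = 0, i = 1 | i = 2].
Proof.
case: i => -[|[|[|//]]] lti;
  by [apply: Or31; apply/val_inj | apply: Or32; apply/val_inj
     | apply: Or33; apply/val_inj].
Qed.

Lemma sum_ord2 (V : nmodType) (F : 'I_2 -> V) : \sum_i F i = F 0 + F 1.
Proof.
by rewrite !big_ord_recl big_ord0 addr0; congr (F _ + F _); apply/val_inj.
Qed.

Lemma sum_ord3 (V : nmodType) (F : 'I_3 -> V) : \sum_i F i = F 0 + F 1 + F 2.
Proof.
rewrite !big_ord_recl big_ord0 addr0 addrA.
by congr (F _ + F _ + F _); apply/val_inj.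
Qed.

Lemma det_mx33 (K : comNzRingType) (A : 'M[K]_3) :
  \det A = A 0 0 * (A 1 1 * A 2 2 - A 1 2 * A 2 1)
         - A 0 1 * (A 1 0 * A 2 2 - A 1 2 * A 2 0)
         + A 0 2 * (A 1 0 * A 2 1 - A 1 1 * A 2 0).
Proof.
(* Indexing the entries by natural numbers lets the nested [lift]s of the cofactor expansion
   compute, so that [ring] recognizes equal entries. *)
have [a AE] : exists a : nat -> nat -> K, forall i j : 'I_3, A i j = a i j.
  by exists (fun i j => A (inord i) (inord j)) => i j; rewrite !inord_val.
rewrite (expand_det_row _ 0) !big_ord_recl big_ord0 /cofactor.
rewrite !(expand_det_row _ 0) !big_ord_recl !big_ord0 /cofactor !det_mx11 !mxE.
rewrite !AE /=; ring.
Qed.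

(** A nonzero 3x3 determinant would force a submatrix of rank 3, exceeding the rank of [M]. The
    determinant is written out so that each instance is directly a polynomial equation. *)
Lemma minor3_eq0 (K : fieldType) m n (M : 'M[K]_(m, n)) i0 i1 i2 j0 j1 j2 :
  (\rank M <= 2)%N ->
  M i0 j0 * (M i1 j1 * M i2 j2 - M i1 j2 * M i2 j1)
  - M i0 j1 * (M i1 j0 * M i2 j2 - M i1 j2 * M i2 j0)
  + M i0 j2 * (M i1 j0 * M i2 j1 - M i1 j1 * M i2 j0) = 0.
Proof.
move=> rkM; pose f := nth i0 [:: i0; i1; i2]; pose g := nth j0 [:: j0; j1; j2].
pose S := mxsub (fun i : 'I_3 => f i) (fun j : 'I_3 => g j) M.
have rkS : (\rank S <= 2)%N.
  apply: leq_trans rkM; rewrite /S mxsubrc rowsubE.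
  apply: leq_trans (mxrankM_maxr _ _) _.
  by rewrite -[M in colsub _ M]mulmx1 -mulmx_colsub mxrankM_maxl.
suff : \det S = 0 by rewrite det_mx33 !mxE.
apply/eqP; apply: contraTT rkS; rewrite -unitfE -unitmxE => /mxrank_unit ->.
by [].
Qed.

End Minors.

(** * Blocks, traces and adjoints of tensor products *)

Section TensorBlocks.
Variable R : realType.
Local Notation C := R[i].

Lemma sum_mxtens (V : nmodType) m n (F : 'I_(m * n) -> V) :
  \sum_k F k = \sum_i \sum_j F (mxtens_index (i, j)).
Proof.
rewrite (reindex (@mxtens_index m n)) /=; last first.
  exists (@mxtens_unindex m n) => k _; first exact: mxtens_indexK.
  exact: mxtens_unindexK.
by rewrite pair_bigA; apply: eq_bigr => -[].
Qed.

Lemma tblockP m n (A B : 'M[C]_(m * n)) :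
  (forall i j, tblock A i j = tblock B i j) -> A = B.
Proof.
move=> eqAB; apply/matrixP => k l.
case: (mxtens_indexP k) => i i'; case: (mxtens_indexP l) => j j'.
by have /matrixP/(_ i' j') := eqAB i j; rewrite !mxE.
Qed.

Lemma tblock_tens m n (A : 'M[C]_m) (B : 'M[C]_n) i j :
  tblock (A *t B) i j = A i j *: B.
Proof. by apply/matrixP => k l; rewrite mxE tensmxE mxE. Qed.

Lemma tblockM m n (A B : 'M[C]_(m * n)) i j :
  tblock (A *m B) i j = \sum_l tblock A i l *m tblock B l j.
Proof.
apply/matrixP => k l; rewrite !mxE sum_mxtens summxE.
by apply: eq_bigr => p _; rewrite mxE; apply: eq_bigr => q _; rewrite !mxE.
Qed.

Lemma tblock_sum m n (I : finType) (F : I -> 'M[C]_(m * n)) i j :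
  tblock (\sum_k F k) i j = \sum_k tblock (F k) i j.
Proof.
apply/matrixP => k l; rewrite mxE !summxE.
by apply: eq_bigr => p _; rewrite mxE.
Qed.

Lemma tblock_id_tens m n (L : 'M[C]_n -> 'M[C]_n) (A : 'M[C]_(m * n)) i j :
  tblock (id_tens L A) i j = L (tblock A i j).
Proof.
rewrite tblock_sum (bigD1 i) //= [X in _ + X]big1 ?addr0 => [|k ki].
  rewrite tblock_sum (bigD1 j) //= [X in _ + X]big1 ?addr0 => [|k kj].
    by rewrite tblock_tens mxE !eqxx scale1r.
  by rewrite tblock_tens mxE eqxx eq_sym (negPf kj) scale0r.
rewrite tblock_sum big1 // => l _.
by rewrite tblock_tens mxE eq_sym (negPf ki) scale0r.
Qed.

Lemma trace_tblock m n (A : 'M[C]_(m * n)) : \tr A = \sum_i \tr (tblock A i i).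
Proof.
rewrite /mxtrace sum_mxtens.
by apply: eq_bigr => i _; apply: eq_bigr => j _; rewrite mxE.
Qed.

Lemma trace_mul_tens m n (M : 'M[C]_(m * n)) (A : 'M[C]_m) (B : 'M[C]_n) :
  \tr (M *m (A *t B)) = \sum_i \sum_j A j i * \tr (tblock M i j *m B).
Proof.
rewrite trace_tblock; apply: eq_bigr => i _; rewrite tblockM raddf_sum.
apply: eq_bigr => j _ /=.
by rewrite tblock_tens -scalemxAr mxtraceZ.
Qed.

Lemma trace_mul_tens1l m n (M : 'M[C]_(m * n)) (B : 'M[C]_n) :
  \tr (M *m (1%:M *t B)) = \tr (ptrace_left M *m B).
Proof.
rewrite trace_mul_tens mulmx_suml raddf_sum; apply: eq_bigr => i _ /=.
rewrite (bigD1 i) //= big1 ?addr0 => [|j ji]; first by rewrite mxE eqxx mul1r.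
by rewrite mxE (negPf ji) mul0r.
Qed.

Lemma tens11 m n : (1%:M : 'M[C]_m) *t (1%:M : 'M[C]_n) = 1%:M.
Proof.
apply/tblockP => i j; rewrite tblock_tens; apply/matrixP => k l; rewrite !mxE.
rewrite (can_eq (@mxtens_indexK _ _)) xpair_eqE.
by case: (i == j); rewrite ?mul1r ?mul0r.
Qed.

Lemma adjmx_tens m n p q (A : 'M[C]_(m, n)) (B : 'M[C]_(p, q)) :
  adjmx (A *t B) = adjmx A *t adjmx B.
Proof. by rewrite /adjmx trmx_tens map_mxT. Qed.

Lemma adjmxM m n p (A : 'M[C]_(m, n)) (B : 'M[C]_(n, p)) :
  adjmx (A *m B) = adjmx B *m adjmx A.
Proof. by rewrite /adjmx trmx_mul map_mxM. Qed.

Lemma adjmxK m n (A : 'M[C]_(m, n)) : adjmx (adjmx A) = A.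
Proof. by apply/matrixP => i j; rewrite !mxE conjCK. Qed.

Lemma adjmx1 n : adjmx 1%:M = 1%:M :> 'M[C]_n.
Proof. by rewrite /adjmx trmx1 map_mx1. Qed.

Lemma adjmxD m n (A B : 'M[C]_(m, n)) : adjmx (A + B) = adjmx A + adjmx B.
Proof. by apply/matrixP => i j; rewrite !mxE rmorphD. Qed.

Lemma adjmxZ m n (c : C) (A : 'M[C]_(m, n)) :
  adjmx (c *: A) = Num.conj c *: adjmx A.
Proof. by apply/matrixP => i j; rewrite !mxE rmorphM. Qed.

Lemma adjmx_delta m n i j : adjmx (delta_mx i j : 'M[C]_(m, n)) = delta_mx j i.
Proof. by apply/matrixP => k l; rewrite !mxE rmorph_nat andbC. Qed.

Lemma unitary_mul_adj n (U : 'M[C]_n) : U \is unitarymx -> U *m adjmx U = 1%:M.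
Proof. by move/unitarymxP. Qed.

Lemma unitary_adj_mul n (U : 'M[C]_n) : U \is unitarymx -> adjmx U *m U = 1%:M.
Proof. by move/unitary_mul_adj/mulmx1C. Qed.

Lemma adjmx_unitary n (U : 'M[C]_n) : U \is unitarymx -> adjmx U \is unitarymx.
Proof. by rewrite -trmxC_unitary. Qed.

Lemma projE n (v : 'cV[C]_n) i j : Defs.proj v i j = v i 0 * Num.conj (v j 0).
Proof. by rewrite mxE big_ord1 !mxE. Qed.

(** Polarization: the form is real at [e_i + c e_j]. Taking [c = 0] gives a real diagonal; [c = 1]
    and [c = i] then determine the conjugates of the sum and of the difference of two opposite
    entries. *)
Lemma psdmx_herm n (A : 'M[C]_n) : psdmx A -> adjmx A = A.
Proof.
move=> psdA.
have form i j (c : C) :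
    A i i + c * A i j + (Num.conj c * A j i + Num.conj c * (c * A j j))
      \is Num.real.
  apply: ger0_real; have := psdA (delta_mx i 0 + c *: delta_mx j 0).
  rewrite adjmxD adjmxZ !adjmx_delta !mulmxDl !mulmxDr.
  rewrite -!scalemxAl -!scalemxAr -!rowE -!colE !mxE.
  by rewrite addrACA.
have diag i : A i i \is Num.real.
  by have := form i i 0; rewrite rmorph0 !mul0r !addr0.
apply/matrixP => i j; rewrite !mxE.
have /CrealP real1 : A j i + A i j \is Num.real.
  have := form j i 1; rewrite rmorph1 !mul1r addrA rpredDr ?diag //.
  by rewrite -addrA rpredDl ?diag.
have /CrealP reali : 'i%R * (A j i - A i j) \is Num.real.
  have := form j i 'i%R.
  rewrite conjCi !mulNr ['i * ('i * _)]mulrA -expr2 sqrCi mulN1r opprK.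
  rewrite addrA rpredDr ?diag //.
  by rewrite -addrA rpredDl ?diag // -mulrBr.
move: reali; rewrite rmorphM rmorphB rmorphD /= conjCi mulNr -mulrN in real1 *.
move/(mulfI (neq0Ci _)) => reali.
apply: (@mulIf _ 2%:R); first by rewrite pnatr_eq0.
transitivity ((Num.conj (A j i) + Num.conj (A i j)) -
              - (Num.conj (A j i) - Num.conj (A i j))); first by ring.
by rewrite real1 reali; ring.
Qed.

End TensorBlocks.

(** * Pauli coordinates and the rank-two obstruction *)

Section PauliTraces.
Variable R : realType.
Local Notation C := R[i].

Lemma sigma0E : sigma R 0 = mx2 0 1 1 0. Proof. by []. Qed.
Lemma sigma1E : sigma R 1 = mx2 0 (- 'i%R) 'i%R 0. Proof. by []. Qed.
Lemma sigma2E : sigma R 2 = mx2 1 0 0 (-1). Proof. by []. Qed.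

Lemma mx2E (a b c d : C) :
  (mx2 a b c d 0 0 = a) * (mx2 a b c d 0 1 = b) *
  (mx2 a b c d 1 0 = c) * (mx2 a b c d 1 1 = d).
Proof. by rewrite !mxE. Qed.

Lemma eta_mx2 (A : 'M[C]_2) : A = mx2 (A 0 0) (A 0 1) (A 1 0) (A 1 1).
Proof.
by apply/matrixP => i j; case: (ord2P i) (ord2P j) => -> [] ->; rewrite !mxE.
Qed.

Lemma mx2_1 : 1%:M = mx2 1 0 0 1 :> 'M[C]_2.
Proof. by rewrite [LHS]eta_mx2 !mxE. Qed.

Lemma trace_mul_mx2 (M : 'M[C]_(2 * 2)) (a b c d a' b' c' d' : C) :
  \tr (M *m (mx2 a b c d *t mx2 a' b' c' d')) =
  let m i j := a' * tblock M i j 0 0 + c' * tblock M i j 0 1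
             + b' * tblock M i j 1 0 + d' * tblock M i j 1 1 in
  a * m 0 0 + c * m 0 1 + b * m 1 0 + d * m 1 1.
Proof.
have tr2 (B : 'M[C]_2) : \tr (B *m mx2 a' b' c' d') =
    a' * B 0 0 + c' * B 0 1 + b' * B 1 0 + d' * B 1 1.
  by rewrite /mxtrace sum_ord2 !mxE !sum_ord2 !mx2E; ring.
rewrite trace_mul_tens !sum_ord2 !tr2 !mx2E /=.
by move: (tblock M) => B; ring.
Qed.

Lemma tens_suml (I : finType) (F : I -> 'M[C]_2) (c : I -> C) (B : 'M[C]_2) :
  (\sum_k c k *: F k) *t B = \sum_k c k *: (F k *t B).
Proof.
apply/tblockP => i j; rewrite tblock_sum tblock_tens summxE scaler_suml.
apply: eq_bigr => k _; rewrite mxE -scalerA -tblock_tens.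
by apply/matrixP => p q; rewrite !mxE.
Qed.

Lemma tens_sumr (I : finType) (F : I -> 'M[C]_2) (c : I -> C) (A : 'M[C]_2) :
  A *t (\sum_k c k *: F k) = \sum_k c k *: (A *t F k).
Proof.
apply/tblockP => i j; rewrite tblock_sum tblock_tens scaler_sumr.
apply: eq_bigr => k _; rewrite scalerA mulrC -scalerA -tblock_tens.
by apply/matrixP => p q; rewrite !mxE.
Qed.

(** The Pauli matrices are an orthogonal basis of the traceless matrices for the trace form; each
    has square of trace 2, hence the division. *)
Lemma traceless_pauli (A : 'M[C]_2) :
  \tr A = 0 -> A = \sum_i (\tr (A *m sigma R i) / 2) *: sigma R i.
Proof.
rewrite (eta_mx2 A) /mxtrace sum_ord2 !mx2E => /eqP.
rewrite addr_eq0 => /eqP ->; set a := A 1 1; set b := A 0 1; set c := A 1 0.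
have ii : 'i%R * 'i%R = -1 :> C by rewrite -expr2 sqrCi.
rewrite sum_ord3 /mxtrace !sum_ord2 sigma0E sigma1E sigma2E.
rewrite ![(mx2 _ _ _ _ *m _) _ _]mxE !sum_ord2 !mx2E [RHS]eta_mx2 !mxE /=.
by congr mx2; field: ii.
Qed.

(** In Pauli coordinates only the diagonal terms survive. Unlike the hypothesis, the basis-free
    conclusion can be evaluated at matrix units and rotated by local unitaries. *)
Lemma correlation_form (M : 'M[C]_(2 * 2)) (tau : C) :
  (forall i j, \tr (M *m (sigma R i *t sigma R j)) = tau *+ (i == j)) ->
  forall A B : 'M[C]_2, \tr A = 0 -> \tr B = 0 ->
  \tr (M *m (A *t B)) = tau / 2 * \tr (A *m B).
Proof.
move=> corM A B trA trB.
rewrite {2}(traceless_pauli trA) {1}(traceless_pauli trA) tens_suml.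
rewrite mulmx_sumr mulmx_suml !raddf_sum mulr_sumr; apply: eq_bigr => i _ /=.
rewrite -scalemxAr -scalemxAl !mxtraceZ [in LHS](traceless_pauli trB) tens_sumr.
rewrite mulmx_sumr raddf_sum (bigD1 i) //= [X in _ + X]big1 => [|j ji].
  rewrite -scalemxAr mxtraceZ corM eqxx mulr1n (mxtrace_mulC (sigma R i)) addr0.
  by field.
by rewrite -scalemxAr mxtraceZ corM eq_sym (negPf ji) mulr0.
Qed.

(* With s the Bloch vector of Bob's marginal, 4 M is
     1+tau+s3  s1-i s2    0         0
     s1+i s2   1-tau-s3   2 tau     0
     0         2 tau      1-tau+s3  s1-i s2
     0         0          s1+i s2   1+tau-s3
   and six of its 3x3 minors suffice to force s = 0. *)
Lemma rank2_marginal (M : 'M[C]_(2 * 2)) (tau : C) :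
  (forall A, \tr (M *m (A *t 1%:M)) = \tr A / 2) ->
  (forall A B : 'M[C]_2, \tr A = 0 -> \tr B = 0 ->
     \tr (M *m (A *t B)) = tau / 2 * \tr (A *m B)) ->
  tau != 0 -> (\rank M <= 2)%N ->
  forall B : 'M[C]_2, \tr B = 0 -> \tr (M *m (1%:M *t B)) = 0.
Proof.
move=> margM corM tau0 rkM.
have tr2 a b c d : \tr (mx2 a b c d) = a + d :> C.
  by rewrite /mxtrace sum_ord2 !mx2E.
have marg a b c d : \tr (M *m (mx2 a b c d *t mx2 1 0 0 1)) = (a + d) / 2.
  by rewrite -mx2_1 margM tr2.
have cor a b c d a' b' c' d' : a + d = 0 -> a' + d' = 0 ->
    \tr (M *m (mx2 a b c d *t mx2 a' b' c' d')) =
    tau / 2 * (a * a' + b * c' + c * b' + d * d').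
  move=> ad ad'; rewrite corM ?tr2 // /mxtrace sum_ord2 !mxE !sum_ord2 !mx2E.
  by congr (_ * _); rewrite !addrA.
have s0 := subrr (1 : C); have z0 := addr0 (0 : C).
(* These helpers solve linear systems: the coefficients of the combination are supplied by hand, and
   [ring] or [field] checks both sides. *)
have lin4 a1 a2 a3 a4 L1 L2 L3 L4 r1 r2 r3 r4 x y :
    L1 = r1 -> L2 = r2 -> L3 = r3 -> L4 = r4 ->
    x = a1 * L1 + a2 * L2 + a3 * L3 + a4 * L4 ->
    y = a1 * r1 + a2 * r2 + a3 * r3 + a4 * r4 -> x = y :> C.
  by move=> -> -> -> -> -> ->.
have lin1 L r x y : L = r -> x = L -> y = r -> x = y :> C by move=> -> -> ->.
have lin2 a1 a2 L1 L2 r1 r2 x y : L1 = r1 -> L2 = r2 ->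
    x = a1 * L1 + a2 * L2 -> y = a1 * r1 + a2 * r2 -> x = y :> C.
  by move=> -> -> -> ->.
(* [c] is the third Bloch coordinate [s3] of Bob's marginal. *)
pose b := tblock M; pose c := b 0 0 0 0 - b 0 0 1 1 + b 1 1 0 0 - b 1 1 1 1.
have tE i j k l : M (mxtens_index (i, k)) (mxtens_index (j, l)) = b i j k l.
  by rewrite /b mxE.
have tr1 := trace_mul_mx2 M; rewrite -/b in tr1.
move: b @c tE tr1 => b c tE tr1.
have trl a b' c' d a' b'' c'' d' x :
    \tr (M *m (mx2 a b' c' d *t mx2 a' b'' c'' d')) = x -> _ = x :=
  fun h => etrans (esym (tr1 _ _ _ _ _ _ _ _)) h.
have b0101 : b 0 1 0 1 = 0.
  have e := trl _ _ _ _ _ _ _ _ _ (cor 0 0 1 0 0 0 1 0 z0 z0).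
  apply: (lin1 _ _ _ _ e) => /=; ring.
have b0110 : b 0 1 1 0 = tau / 2.
  have e := trl _ _ _ _ _ _ _ _ _ (cor 0 0 1 0 0 1 0 0 z0 z0).
  apply: (lin1 _ _ _ _ e) => /=; ring.
have b1010 : b 1 0 1 0 = 0.
  have e := trl _ _ _ _ _ _ _ _ _ (cor 0 1 0 0 0 1 0 0 z0 z0).
  apply: (lin1 _ _ _ _ e) => /=; ring.
have b1001 : b 1 0 0 1 = tau / 2.
  have e := trl _ _ _ _ _ _ _ _ _ (cor 0 1 0 0 0 0 1 0 z0 z0).
  apply: (lin1 _ _ _ _ e) => /=; ring.
have [b0100 b0111] : b 0 1 0 0 = 0 /\ b 0 1 1 1 = 0.
  have e1 := trl _ _ _ _ _ _ _ _ _ (cor 0 0 1 0 1 0 0 (-1) z0 s0).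
  have e2 := trl _ _ _ _ _ _ _ _ _ (marg 0 0 1 0).
  split; [apply: (lin2 2^-1 2^-1 _ _ _ _ _ _ e1 e2) => /=; by field |
          apply: (lin2 (- 2^-1) 2^-1 _ _ _ _ _ _ e1 e2) => /=; by field].
have [b1000 b1011] : b 1 0 0 0 = 0 /\ b 1 0 1 1 = 0.
  have e1 := trl _ _ _ _ _ _ _ _ _ (cor 0 1 0 0 1 0 0 (-1) z0 s0).
  have e2 := trl _ _ _ _ _ _ _ _ _ (marg 0 1 0 0).
  split; [apply: (lin2 2^-1 2^-1 _ _ _ _ _ _ e1 e2) => /=; by field |
          apply: (lin2 (- 2^-1) 2^-1 _ _ _ _ _ _ e1 e2) => /=; by field].
have b1101 : b 1 1 0 1 = b 0 0 0 1.
  have e := trl _ _ _ _ _ _ _ _ _ (cor 1 0 0 (-1) 0 0 1 0 s0 z0).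
  apply/esym/eqP; rewrite -subr_eq0; apply/eqP.
  apply: (lin1 _ _ _ _ e) => /=; ring.
have b1110 : b 1 1 1 0 = b 0 0 1 0.
  have e := trl _ _ _ _ _ _ _ _ _ (cor 1 0 0 (-1) 0 1 0 0 s0 z0).
  apply/esym/eqP; rewrite -subr_eq0; apply/eqP.
  apply: (lin1 _ _ _ _ e) => /=; ring.
have e1 := trl _ _ _ _ _ _ _ _ _ (marg 1 0 0 1).
have e2 := trl _ _ _ _ _ _ _ _ _ (marg 1 0 0 (-1)).
have e3 := trl _ _ _ _ _ _ _ _ _ (cor 1 0 0 (-1) 1 0 0 (-1) s0 s0).
have e4 : b 0 0 0 0 - b 0 0 1 1 + b 1 1 0 0 - b 1 1 1 1 = c by [].
have b0000 : b 0 0 0 0 = (1 + tau + c) / 4.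
  apply: (lin4 4^-1 4^-1 4^-1 4^-1 _ _ _ _ _ _ _ _ _ _ e1 e2 e3 e4);
    by field.
have b0011 : b 0 0 1 1 = (1 - tau - c) / 4.
  apply: (lin4 4^-1 4^-1 (-4^-1) (-4^-1) _ _ _ _ _ _ _ _ _ _ e1 e2 e3 e4);
    by field.
have b1100 : b 1 1 0 0 = (1 - tau + c) / 4.
  apply: (lin4 4^-1 (-4^-1) (-4^-1) 4^-1 _ _ _ _ _ _ _ _ _ _ e1 e2 e3 e4);
    by field.
have b1111 : b 1 1 1 1 = (1 + tau - c) / 4.
  apply: (lin4 4^-1 (-4^-1) 4^-1 (-4^-1) _ _ _ _ _ _ _ _ _ _ e1 e2 e3 e4);
    by field.
pose x i j : 'I_(2 * 2) := mxtens_index (i, j).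
have minor i0 i1 i2 j0 j1 j2 := minor3_eq0 i0 i1 i2 j0 j1 j2 rkM.
(* The first two minors are triangular, with diagonal product proportional to [tau] times the square
   of an off-diagonal entry of Bob's marginal; the other four are principal. *)
have := minor (x 0 0) (x 0 1) (x 1 0) (x 0 1) (x 1 0) (x 1 1).
have := minor (x 0 1) (x 1 0) (x 1 1) (x 0 0) (x 0 1) (x 1 0).
have := minor (x 0 0) (x 0 1) (x 1 0) (x 0 0) (x 0 1) (x 1 0).
have := minor (x 0 1) (x 1 0) (x 1 1) (x 0 1) (x 1 0) (x 1 1).
have := minor (x 0 0) (x 0 1) (x 1 1) (x 0 0) (x 0 1) (x 1 1).
have := minor (x 0 0) (x 1 0) (x 1 1) (x 0 0) (x 1 0) (x 1 1).
rewrite !tE b0101 b0110 b1010 b1001 b0100 b0111 b1000 b1011 b1101 b1110.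
move=> m6 m5 m4 m3 m2 m1.
have z0010 : b 0 0 1 0 = 0.
  suff : tau * b 0 0 1 0 ^+ 2 == 0.
    by rewrite mulf_eq0 (negPf tau0) sqrf_eq0 => /eqP.
  apply/eqP; rewrite -[RHS](mulr0 2) -m2; by field.
have z0001 : b 0 0 0 1 = 0.
  suff : tau * b 0 0 0 1 ^+ 2 == 0.
    by rewrite mulf_eq0 (negPf tau0) sqrf_eq0 => /eqP.
  apply/eqP; rewrite -[RHS](mulr0 2) -m1; by field.
suff c0 : c = 0.
  move=> B; rewrite (eta_mx2 B) tr2 => /eqP; rewrite addr_eq0 => /eqP trB.
  rewrite mx2_1 tr1 /= trB b1101 b1110 z0010 z0001.
  transitivity (- B 1 1 * c); first by rewrite /c; ring.
  by rewrite c0 mulr0.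
rewrite b0000 b0011 b1100 b1111 z0010 z0001 in m3 m4 m5 m6.
(* With [s1 = s2 = 0], the principal minors pair up under [c -> - c]; each difference keeps only the
   part odd in [c]. *)
have cD : c * ((1 - tau) ^+ 2 - c ^+ 2 - 4 * tau ^+ 2) = 0.
  by apply: (lin2 32 (- 32) _ _ _ _ _ _ m3 m4); field.
have cP : c * ((1 + tau) ^+ 2 - c ^+ 2) = 0.
  by apply: (lin2 32 (- 32) _ _ _ _ _ _ m6 m5); field.
have ct : c * (1 + tau) = 0.
  apply: (mulfI tau0).
  by apply: (lin2 4^-1 (- 4^-1) _ _ _ _ _ _ cP cD); field.
(* Subtracting [cP] from [1 + tau] times [ct] leaves [c ^+ 3]. *)
apply/eqP; rewrite -[_ == _](@expf_eq0 _ c 3); apply/eqP.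
by apply: (lin2 (1 + tau) (- 1) _ _ _ _ _ _ ct cP); ring.
Qed.

End PauliTraces.

(** * Bob's conditional states after a Bell measurement *)

Section Fidelity.
Variable R : realType.
Local Notation C := R[i].

(** The sandwich is [proj b] tensored with the contraction of [J] by [b] on both sides; the trace of
    [proj b] is the leading scalar. *)
Lemma ptrace_left_proj m n (b : 'cV[C]_m) (J : 'M[C]_(m * n)) :
  let P := Defs.proj b *t (1%:M : 'M[C]_n) in
  ptrace_left (P *m J *m P) =
  (\sum_i Num.conj (b i 0) * b i 0) *:
    (\sum_j \sum_l (Num.conj (b j 0) * b l 0) *: tblock J j l).
Proof.
move=> P; rewrite scaler_suml; apply: eq_bigr => i _.
rewrite tblockM exchange_big /= scaler_sumr; apply: eq_bigr => l _.
rewrite tblockM tblock_tens mulmx_suml scaler_sumr; apply: eq_bigr => j _.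
rewrite tblock_tens -!scalemxAr !mulmx1 -scalemxAl mul1mx !scalerA !projE.
by congr (_ *: _); ring.
Qed.

Lemma tblock_joint (rho : 'M[C]_(2 * 2)) (psi : 'cV[C]_2) a b a' b' :
  tblock (castmx (mulnA 2 2 2, mulnA 2 2 2) (Defs.proj psi *t rho)
            : 'M[C]_((2 * 2) * 2))
    (mxtens_index (a, b)) (mxtens_index (a', b')) =
  (psi a 0 * Num.conj (psi a' 0)) *: tblock rho b b'.
Proof.
(* Both groupings of three bits number the basis identically, so [castmx] merely reassociates
   indices. *)
have assoc (i j k : 'I_2) : cast_ord (esym (mulnA 2 2 2))
      (mxtens_index (mxtens_index (i, j), k)) =
    mxtens_index (i, mxtens_index (j, k)).
  by apply/val_inj; rewrite /= mulnDl -mulnA addnA.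
apply/matrixP => k l; rewrite mxE castmxE /= !assoc tensmxE projE.
by rewrite !mxE.
Qed.

Lemma pauli_herm k : adjmx (pauli R k) = pauli R k.
Proof.
rewrite [LHS]eta_mx2 !mxE; case: k => -[|[|[|[|//]]]] ltk; rewrite /pauli /=.
- by rewrite mx2_1 !mx2E !rmorph0 !rmorph1.
- by rewrite !mx2E !rmorph0 !rmorph1.
- by rewrite !mx2E !rmorph0 rmorphN /= conjCi opprK.
- by rewrite !mx2E rmorphN !rmorph0 !rmorph1.
Qed.

Lemma pauli_sq k : pauli R k *m pauli R k = 1%:M.
Proof.
have ii : 'i%R * 'i%R = -1 :> C by rewrite -expr2 sqrCi.
rewrite [LHS]eta_mx2 !mxE !sum_ord2.
case: k => -[|[|[|[|//]]]] ltk; rewrite /pauli /= mx2_1 !mx2E.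
- by congr mx2; ring.
- by congr mx2; ring.
- by congr mx2; ring: ii.
- by congr mx2; ring.
Qed.

Lemma bellE k a b : bell R k (mxtens_index (a, b)) 0 =
  (Num.sqrt 2)^-1%:C * (if b == 0 then - pauli R k a 1 else pauli R k a 0).
Proof.
rewrite mxE sum_mxtens !sum_ord2 !tensmxE !mxE !mxtens_indexK /=.
by case: (ord2P b) => -> /=; ring.
Qed.

Lemma conj_inv_sqrt2 :
  Num.conj ((Num.sqrt 2)^-1%:C : C) = (Num.sqrt 2)^-1%:C.
Proof. exact: conjc_real. Qed.

Lemma sqr_inv_sqrt2 : (Num.sqrt 2)^-1%:C * (Num.sqrt 2)^-1%:C = 2^-1 :> C.
Proof.
rewrite -rmorphM -expr2 exprVn sqr_sqrtr ?ler0n //.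
by rewrite rmorphV ?unitfE ?pnatr_eq0 // rmorph_nat.
Qed.

Lemma pauli_conj k i j : Num.conj (pauli R k i j) = pauli R k j i.
Proof. by have /matrixP/(_ j i) := pauli_herm k; rewrite !mxE. Qed.

Lemma bell_normalized k : \sum_i Num.conj (bell R k i 0) * bell R k i 0 = 1.
Proof.
have /matrixP psq := pauli_sq k; have := psq 0 0; have := psq 1 1.
rewrite !mxE !sum_ord2 /= sum_mxtens !sum_ord2 !bellE /= !rmorphM !rmorphN /=.
rewrite conj_inv_sqrt2 !pauli_conj; set p := pauli R k => p11 p00.
set s := _%:C; transitivity (s * s * ((p 0 0 * p 0 0 + p 0 1 * p 1 0)
                       + (p 1 0 * p 0 1 + p 1 1 * p 1 1))); first by ring.
by rewrite p00 p11 sqr_inv_sqrt2; field.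
Qed.

(** Outcome [k] projects Alice's half of [rho] onto [(conj y, - conj x)], the vector orthogonal to
    [pauli k *m psi]; the factor 1/2 comes from the normalization of the singlet. *)
Lemma bob_stateE (rho : 'M[C]_(2 * 2)) (psi : 'cV[C]_2) k :
  let x := (pauli R k *m psi) 0 0 in let y := (pauli R k *m psi) 1 0 in
  bob_state rho psi k =
  2^-1 *: ((y * Num.conj y) *: tblock rho 0 0
           - (y * Num.conj x) *: tblock rho 0 1
           - (x * Num.conj y) *: tblock rho 1 0
           + (x * Num.conj x) *: tblock rho 1 1).
Proof.
move=> x y; rewrite /bob_state ptrace_left_proj bell_normalized scale1r.
have xE : x = pauli R k 0 0 * psi 0 0 + pauli R k 0 1 * psi 1 0.
  by rewrite /x mxE sum_ord2.
have yE : y = pauli R k 1 0 * psi 0 0 + pauli R k 1 1 * psi 1 0.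
  by rewrite /y mxE sum_ord2.
rewrite !(sum_mxtens, sum_ord2) !tblock_joint !bellE /= -sqr_inv_sqrt2 xE yE.
rewrite !rmorphD !rmorphM !rmorphN /= conj_inv_sqrt2 !pauli_conj.
rewrite !scalerA {xE yE}.
move: (tblock rho) (pauli R k) {x y} => B p; apply/matrixP => i j; rewrite !mxE.
ring.
Qed.

End Fidelity.

(** * The fidelity as a polynomial in the input amplitudes *)

Section FidelityFormula.
Variable R : realType.
Local Notation C := R[i].

(* On outcome k the output has fidelity <w|rho|w> / 2 with w = v (x) chi, where
   chi = sigma_k psi and v is orthogonal to chi; summing over k keeps only the
   diagonal correlations of rho, weighted by the squared coordinates of the
   (unnormalized) Bloch vector of psi. *)
Lemma fidelityE (rho : 'M[C]_(2 * 2)) (psi : 'cV[C]_2) :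
  let x := psi 0 0 in let y := psi 1 0 in
  let x' := Num.conj x in let y' := Num.conj y in
  fidelity rho psi = complex.Re (2^-1 *
    ((x * x' + y * y') ^+ 2 * \tr rho
     - (x' * y + x * y') ^+ 2 * \tr (rho *m (sigma R 0 *t sigma R 0))
     + (x' * y - x * y') ^+ 2 * \tr (rho *m (sigma R 1 *t sigma R 1))
     - (x * x' - y * y') ^+ 2 * \tr (rho *m (sigma R 2 *t sigma R 2)))).
Proof.
move=> x y x' y'; congr complex.Re.
have quad (v : 'cV[C]_2) (B : 'M[C]_2) : (adjmx v *m B *m v) 0 0 =
    Num.conj (v 0 0) * (B 0 0 * v 0 0 + B 0 1 * v 1 0)
    + Num.conj (v 1 0) * (B 1 0 * v 0 0 + B 1 1 * v 1 0).
  by rewrite mxE sum_ord2 !mxE !sum_ord2 !mxE; ring.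
rewrite mulmx_sumr mulmx_suml summxE.
pose b := tblock rho.
(* [u'] and [v'] stand for the conjugates of [u] and [v], kept as independent variables so that the
   final identity is polynomial. *)
pose q (u v u' v' : C) := 2^-1 *
  (v * v' * (u' * (b 0 0 0 0 * u + b 0 0 0 1 * v)
            + v' * (b 0 0 1 0 * u + b 0 0 1 1 * v))
 - v * u' * (u' * (b 0 1 0 0 * u + b 0 1 0 1 * v)
            + v' * (b 0 1 1 0 * u + b 0 1 1 1 * v))
 - u * v' * (u' * (b 1 0 0 0 * u + b 1 0 0 1 * v)
            + v' * (b 1 0 1 0 * u + b 1 0 1 1 * v))
 + u * u' * (u' * (b 1 1 0 0 * u + b 1 1 0 1 * v)
            + v' * (b 1 1 1 0 * u + b 1 1 1 1 * v))).
have qE (k : 'I_4) (u v : C) :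
    (pauli R k *m psi) 0 0 = u -> (pauli R k *m psi) 1 0 = v ->
    (adjmx psi *m (pauli R k *m bob_state rho psi k *m adjmx (pauli R k))
      *m psi) 0 0 = q u v (Num.conj u) (Num.conj v).
  move=> uE vE.
  have -> : adjmx psi *m (pauli R k *m bob_state rho psi k *m adjmx (pauli R k))
      *m psi =
    adjmx (pauli R k *m psi) *m bob_state rho psi k *m (pauli R k *m psi).
    by rewrite adjmxM pauli_herm !mulmxA.
  rewrite quad uE vE bob_stateE uE vE -/b /q {q}.
  by move: b => b; rewrite !mxE; ring.
have ii : 'i%R * 'i%R = -1 :> C by rewrite -expr2 sqrCi.
rewrite !big_ord_recl big_ord0.
have pv0 a b' c d : (mx2 a b' c d *m psi) 0 0 = a * x + b' * y.
  by rewrite mxE sum_ord2 !mx2E.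
have pv1 a b' c d : (mx2 a b' c d *m psi) 1 0 = c * x + d * y.
  by rewrite mxE sum_ord2 !mx2E.
have p0 i : (pauli R ord0 *m psi) i 0 = psi i 0 by rewrite /pauli mul1mx.
have E0 := qE ord0 x y (p0 0) (p0 1).
have E1 := qE (lift ord0 ord0) _ _ (pv0 0 1 1 0) (pv1 0 1 1 0).
have E2 := qE (lift ord0 (lift ord0 ord0)) _ _
  (pv0 0 (- 'i%R) 'i%R 0) (pv1 0 (- 'i%R) 'i%R 0).
have E3 := qE (lift ord0 (lift ord0 (lift ord0 ord0))) _ _
  (pv0 1 0 0 (-1)) (pv1 1 0 0 (-1)).
apply: etrans (congr2 +%R E0 (congr2 +%R E1 (congr2 +%R E2
  (congr2 +%R E3 (erefl 0))))) _.
rewrite {E0 E1 E2 E3 pv0 pv1 p0 qE}.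
rewrite !rmorphD !rmorphM !rmorphN !rmorph0 !rmorph1 /= conjCi -/x' -/y'.
rewrite sigma0E sigma1E sigma2E !trace_mul_mx2.
rewrite trace_tblock sum_ord2 /mxtrace !sum_ord2 /q -/b /= {q}.
move: x y x' y' b => x y x' y' b.
ring: ii.
Qed.

End FidelityFormula.

(** * The fidelity in Bloch-sphere coordinates *)

Section BlochFidelity.
Variable R : realType.
Local Notation C := R[i].

Lemma fidelity_bloch (rho : 'M[C]_(2 * 2)) (theta phi : R) :
  fidelity rho (bloch_ket theta phi) = 2^-1 *
    (complex.Re (\tr rho)
     - (sin theta * cos phi) ^+ 2 * correlation_mx rho 0 0
     - (sin theta * sin phi) ^+ 2 * correlation_mx rho 1 1
     - cos theta ^+ 2 * correlation_mx rho 2 2).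
Proof.
rewrite fidelityE [_ 0 0]mxE [_ 1 0]mxE !mxE /=.
rewrite !mulr1 !mulr0 !addr0 !add0r.
set c := cos (theta / 2); set s := sin (theta / 2).
have th : theta = (theta / 2) *+ 2 by rewrite -mulr_natr divfK.
have cosE : cos theta = c ^+ 2 - s ^+ 2.
  rewrite th cos_mulr2n -/c.
  have := cos2Dsin2 (theta / 2); rewrite -/c -/s => h.
  by rewrite -h; ring.
have sinE : sin theta = 2 * c * s by rewrite th sin_mulr2n -/c -/s; ring.
have cs1 : c ^+ 2 + s ^+ 2 = 1 by exact: cos2Dsin2.
have p1 := cos2Dsin2 phi.
set x := c%:C; set y := (cos phi +i* sin phi) * s%:C.
have xE : Num.conj x = x by exact: conjc_real.
have yE : Num.conj y = (cos phi -i* sin phi) * s%:C.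
  by rewrite /y rmorphM; congr (_ * _); exact: conjc_real.
rewrite xE yE.
have -> : x * x + y * ((cos phi -i* sin phi) * s%:C) = 1.
  apply/eqP; rewrite eq_complex /=; apply/andP; split; apply/eqP; last by ring.
  rewrite -[RHS]cs1 -[s ^+ 2]mulr1 -p1; ring.
have -> : x * y + x * ((cos phi -i* sin phi) * s%:C) = (sin theta * cos phi)%:C.
  by apply/eqP; rewrite eq_complex /= sinE; apply/andP; split; apply/eqP; ring.
(* The difference is [i] times the second Bloch coordinate; only its square is real. *)
have -> : (x * y - x * ((cos phi -i* sin phi) * s%:C)) ^+ 2
    = (- (sin theta * sin phi) ^+ 2)%:C.
  rewrite expr2.
  by apply/eqP; rewrite eq_complex /= sinE; apply/andP; split; apply/eqP; ring.
have -> : x * x - y * ((cos phi -i* sin phi) * s%:C) = (cos theta)%:C.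
  apply/eqP; rewrite eq_complex /= cosE.
  apply/andP; split; apply/eqP; last by ring.
  rewrite -[s ^+ 2]mulr1 -p1; ring.
have ReZ (a : R) (z : C) : complex.Re (a%:C * z) = a * complex.Re z.
  by case: z => u v /=; ring.
have ReD (u v : C) : complex.Re (u + v) = complex.Re u + complex.Re v.
  by case: u v => ? ? [].
have ReN (u : C) : complex.Re (- u) = - complex.Re u by case: u.
have -> : 2^-1 = (2^-1)%:C :> C.
  by rewrite rmorphV ?unitfE ?pnatr_eq0 // rmorph_nat.
rewrite -!rmorphXn expr1n mul1r.
rewrite ReZ; congr (_ * _).
do 4 move: (\tr _) => ?.
by rewrite !ReD !ReN !ReZ mulNr.
Qed.

End BlochFidelity.

(** * Averages over the Bloch sphere *)

Section BlochAverage.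
Variable R : realType.

Lemma Rintegral_derive (F f : R -> R) (a b : R) : a < b ->
  (forall x : R, is_derive x 1 F (f x)) -> (forall x : R, derivable f x 1) ->
  \int[lebesgue_measure]_(x in `[a, b]) f x = F b - F a.
Proof.
move=> ab dF df.
have cont (g : R -> R) (x : R) : derivable g x 1 -> {for x, continuous g}.
  by move=> /derivable1_diffP/differentiable_continuous.
have dF' (x : R) : derivable F x 1 by have := dF x; case.
rewrite /Rintegral (@continuous_FTC2 _ f F) //.
- apply: continuous_subspaceT => x; exact: cont.
- split.
  + by move=> x _.
  + apply: cvg_at_right_filter; exact: cont.
  + apply: cvg_at_left_filter; exact: cont.
- by move=> x _; rewrite derive1E; apply: derive_val.
Qed.

Lemma Rintegral_cos24 (a b c : R) :
  \int[lebesgue_measure]_(x in `[0, 2 * pi])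
    (a + b * cos x ^+ 2 + c * cos x ^+ 4)
  = 2 * pi * (a + b / 2 + 3 / 8 * c).
Proof.
(* The sine terms of this primitive vanish at both endpoints, leaving the means 1/2 and 3/8 of
   [cos ^+ 2] and [cos ^+ 4]. *)
pose F (x : R) := a * x + b * (2^-1 * x + 2^-1 * (sin x * cos x))
  + c * (3 / 8 * x + 3 / 8 * (sin x * cos x) + 4^-1 * (sin x * cos x ^+ 3)).
have dF (x : R) : is_derive x 1 F (a + b * cos x ^+ 2 + c * cos x ^+ 4).
  rewrite /F; apply: is_derive_eq.
  have s2 := sin2cos2 x.
  rewrite /GRing.scale /= !mulr1.
  by field: s2.
rewrite (Rintegral_derive _ dF) //.
- rewrite /F mulr_natl sin2pi cos2pi sin0 cos0 -[pi *+ 2]mulr_natl; by field.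
- by rewrite mulr_gt0 ?pi_gt0.
Qed.

Lemma Rintegral_sin_cos24 (a b c : R) :
  \int[lebesgue_measure]_(x in `[0, pi])
    (sin x * (a + b * cos x ^+ 2 + c * cos x ^+ 4)) =
  2 * (a + b / 3 + c / 5).
Proof.
pose F (x : R) := - (a * cos x + b / 3 * cos x ^+ 3 + c / 5 * cos x ^+ 5).
have dF (x : R) :
    is_derive x 1 F (sin x * (a + b * cos x ^+ 2 + c * cos x ^+ 4)).
  rewrite /F; apply: is_derive_eq.
  by rewrite /GRing.scale /=; field.
rewrite (Rintegral_derive _ dF) ?pi_gt0 //.
by rewrite /F cospi cos0; field.
Qed.

(** The second hypothesis records the average over [phi]; on the sphere, [cos theta ^+ 2] and
    [cos theta ^+ 4] then have means 1/3 and 1/5. *)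
Lemma qubit_avgE (f : 'cV[R[i]]_2 -> R) (A B D : R -> R) (p q r : R) :
  (forall theta phi, f (bloch_ket theta phi) =
     A theta + B theta * cos phi ^+ 2 + D theta * cos phi ^+ 4) ->
  (forall theta, A theta + B theta / 2 + 3 / 8 * D theta =
     p + q * cos theta ^+ 2 + r * cos theta ^+ 4) ->
  qubit_avg f = p + q / 3 + r / 5.
Proof.
move=> fE avgE; rewrite /qubit_avg.
have inner theta : \int[lebesgue_measure]_(phi in `[0, 2 * pi])
    f (bloch_ket theta phi) =
    2 * pi * (p + q * cos theta ^+ 2 + r * cos theta ^+ 4).
  rewrite -avgE -Rintegral_cos24; apply: eq_Rintegral => phi _; exact: fE.
have outer : \int[lebesgue_measure]_(theta in `[0, pi])
    (sin theta * \int[lebesgue_measure]_(phi in `[0, 2 * pi])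
      f (bloch_ket theta phi)) =
    2 * (2 * pi * p + 2 * pi * q / 3 + 2 * pi * r / 5).
  rewrite -Rintegral_sin_cos24; apply: eq_Rintegral => theta _.
  by rewrite inner; ring.
have pi0 : pi != 0 :> R by rewrite lt0r_neq0 ?pi_gt0.
rewrite outer; move: (pi) pi0 => w w0; by field.
Qed.

End BlochAverage.

(** * Zero deviation, and the fidelity of uncorrelated states *)

Section Usefulness.
Variable R : realType.
Local Notation C := R[i].

Lemma fidelity_stddev_eq0 (rho : 'M[C]_(2 * 2)) :
  fidelity_stddev rho = 0 ->
  forall i j, correlation_mx rho i i = correlation_mx rho j j.
Proof.
set T := correlation_mx rho; move=> /eqP; rewrite sqrtr_eq0.
(* The deviation from the mean is [a theta + b theta * cos phi ^+ 2]; its average over [phi] is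
   [p + q * cos theta ^+ 2]. *)
pose m := avg_fidelity rho; pose t := complex.Re (\tr rho).
pose r := (T 1 1 - T 0 0) / 2; pose q := (T 1 1 - T 2 2) / 2 - r / 2.
pose p := (t - T 1 1) / 2 - m + r / 2.
pose a x : R := (t - sin x ^+ 2 * T 1 1 - cos x ^+ 2 * T 2 2) / 2 - m.
pose b x : R := sin x ^+ 2 * r.
rewrite (@qubit_avgE _ _ (fun x => a x ^+ 2) (fun x => 2 * a x * b x)
  (fun x => b x ^+ 2) (p ^+ 2 + r ^+ 2 / 8) (2 * p * q - r ^+ 2 / 4)
  (q ^+ 2 + r ^+ 2 / 8)); first last.
- by move=> x; rewrite /a /b sin2cos2 /p /q; field.
- move=> x y; rewrite fidelity_bloch -/T -/t -/m /a /b !exprMn (sin2cos2 y) /r.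
  by field.
(* As [Num.sqrt] vanishes on all nonpositive reals, only [<= 0] is known of the variance. Completing
   the square makes it a positive combination of squares, which forces [q = r = 0]. *)
move=> le0.
have sq : p ^+ 2 + r ^+ 2 / 8 + (2 * p * q - r ^+ 2 / 4) / 3
    + (q ^+ 2 + r ^+ 2 / 8) / 5 =
    (p + q / 3) ^+ 2 + 4 / 45 * q ^+ 2 + 15^-1 * r ^+ 2.
  by field.
have h1 := sqr_ge0 (p + q / 3); have h2 := sqr_ge0 q; have h3 := sqr_ge0 r.
rewrite sq in le0.
have r0 : r = 0 by apply/eqP; rewrite -sqrf_eq0 eq_le h3 andbT; lra.
have q0 : q = 0 by apply/eqP; rewrite -sqrf_eq0 eq_le h2 andbT; lra.
have T01 : T 0 0 = T 1 1 by move: r0; rewrite /r => r0; lra.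
have T12 : T 2 2 = T 1 1 by move: q0; rewrite /q r0 => q0; lra.
have all1 i : T i i = T 1 1.
  by have [->|->|->] := ord3P i.
by move=> i j; rewrite !all1.
Qed.

Lemma avg_fidelity_uncorrelated (rho : 'M[C]_(2 * 2)) :
  \tr rho = 1 -> (forall i, correlation_mx rho i i = 0) ->
  avg_fidelity rho = 2^-1.
Proof.
move=> tr1 T0; rewrite /avg_fidelity.
rewrite (@qubit_avgE _ _ (fun=> 2^-1) (fun=> 0) (fun=> 0) 2^-1 0 0).
- by ring.
- by move=> x y; rewrite fidelity_bloch !T0 tr1 /=; field.
- by move=> x; ring.
Qed.

End Usefulness.

(** * Behaviour of states and observables under local unitaries *)

Section LocalUnitaries.
Variable R : realType.
Local Notation C := R[i].

Lemma trace_sigma i : \tr (sigma R i) = 0.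
Proof.
case: i => -[|[|[|//]]] lti; rewrite /sigma /pauli /mxtrace sum_ord2 /= !mx2E.
- exact: addr0.
- exact: addr0.
- exact: subrr.
Qed.

Lemma trace_unitary_conj n (U A : 'M[C]_n) : U \is unitarymx ->
  \tr (U *m A *m adjmx U) = \tr A.
Proof. by move=> uU; rewrite mxtrace_mulC mulmxA unitary_adj_mul // mul1mx. Qed.

(** Heisenberg picture: cyclicity of the trace moves [U] and [V] from the state to the
    observables. *)
Lemma trace_local_unitary (U V A B : 'M[C]_2) (rho : 'M[C]_(2 * 2)) :
  \tr (local_unitary U V rho *m (A *t B)) =
  \tr (rho *m ((adjmx U *m A *m U) *t (adjmx V *m B *m V))).
Proof.
rewrite /local_unitary -!mulmxA mxtrace_mulC -!mulmxA adjmx_tens.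
by rewrite !tensmx_mul.
Qed.

Lemma trace_mul_local_unitary (U V A B : 'M[C]_2) (rho : 'M[C]_(2 * 2)) :
  U \is unitarymx -> V \is unitarymx ->
  \tr (rho *m (A *t B)) = \tr (local_unitary U V rho *m
    ((U *m A *m adjmx U) *t (V *m B *m adjmx V))).
Proof.
have conjK (W X : 'M[C]_2) : W \is unitarymx ->
    adjmx W *m (W *m X *m adjmx W) *m W = X.
  move=> uW; rewrite !mulmxA unitary_adj_mul // mul1mx -mulmxA.
  by rewrite unitary_adj_mul // mulmx1.
by move=> uU uV; rewrite trace_local_unitary !conjK.
Qed.

Lemma local_unitary_herm (U V : 'M[C]_2) (rho : 'M[C]_(2 * 2)) :
  adjmx rho = rho -> adjmx (local_unitary U V rho) = local_unitary U V rho.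
Proof. by move=> h; rewrite /local_unitary !adjmxM adjmxK h mulmxA. Qed.

Lemma rank_local_unitary (U V : 'M[C]_2) (rho : 'M[C]_(2 * 2)) :
  U \is unitarymx -> V \is unitarymx ->
  \rank (local_unitary U V rho) = \rank rho.
Proof.
move=> uU uV.
have UV1 : (U *t V) *m adjmx (U *t V) = 1%:M.
  by rewrite adjmx_tens tensmx_mul !unitary_mul_adj // tens11.
have [UV UV'] := mulmx1_unit UV1.
rewrite /local_unitary mxrankMfree ?row_free_unit //.
by rewrite eqmxMfull // row_full_unit.
Qed.

Lemma trace_adjmx n (A : 'M[C]_n) : \tr (adjmx A) = Num.conj (\tr A).
Proof. by rewrite /mxtrace rmorph_sum; apply: eq_bigr => i _; rewrite !mxE. Qed.

(** The trace of a product of two Hermitian matrices is its own conjugate, so [complex.Re] loses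
    nothing. *)
Lemma correlation_mxE (rho : 'M[C]_(2 * 2)) i j : adjmx rho = rho ->
  \tr (rho *m (sigma R i *t sigma R j)) = (correlation_mx rho i j)%:C.
Proof.
move=> rhoH; rewrite /correlation_mx mxE RRe_real //; apply/CrealP.
by rewrite -trace_adjmx adjmxM adjmx_tens rhoH !pauli_herm mxtrace_mulC.
Qed.

(** Quantifying over all traceless pairs makes the hypothesis stable under local unitaries, so every
    average fidelity is 1/2, below 2/3. *)
Lemma uncorrelated_not_useful (rho : 'M[C]_(2 * 2)) : \tr rho = 1 ->
  (forall A B : 'M[C]_2, \tr A = 0 -> \tr B = 0 -> \tr (rho *m (A *t B)) = 0) ->
  ~ useful rho.
Proof.
move=> tr1 rho0; rewrite /useful /max_avg_fidelity.
have avg U V : U \is unitarymx -> V \is unitarymx ->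
    avg_fidelity (local_unitary U V rho) = 2^-1.
  move=> uU uV.
  have trJ (W A : 'M[C]_2) : W \is unitarymx -> \tr (adjmx W *m A *m W) = \tr A.
    by move=> /adjmx_unitary/trace_unitary_conj; rewrite adjmxK => /(_ A).
  apply: avg_fidelity_uncorrelated => [|i].
    rewrite -[local_unitary _ _ _]mulmx1 -tens11 trace_local_unitary !mulmx1.
    by rewrite !unitary_adj_mul // tens11 mulmx1.
  rewrite /correlation_mx mxE trace_local_unitary rho0 //;
    by rewrite trJ // trace_sigma.
(* The identity unitaries make the set nonempty, hence exactly a singleton, and [sup] takes its
   intended value. *)
rewrite (_ : [set _ | _] = [set 2^-1]) ?sup1; first lra.
apply/seteqP; split => [r [U [V [uU uV ->]]]|r ->] /=; first exact: avg.
have u1 : (1%:M : 'M[C]_2) \is unitarymx.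
  by apply/unitarymxP; rewrite mul1mx; exact: adjmx1.
by exists 1%:M, 1%:M; split; rewrite ?avg.
Qed.

End LocalUnitaries.

(** * Marginals and rank of the Choi state *)

Section ChoiState.
Variable R : realType.
Local Notation C := R[i].
Implicit Types L : {linear 'M[C]_2 -> 'M[C]_2}.

Lemma tblock_Phi1 i j : tblock (Defs.proj (Phi1 R)) i j = 2^-1 *: delta_mx i j.
Proof.
have Phi1E a b :
    Phi1 R (mxtens_index (a, b)) 0 = (Num.sqrt 2)^-1%:C * (a == b)%:R.
  rewrite !mxE !mxtens_indexK /=.
  by case: (ord2P a) (ord2P b) => -> [] ->; rewrite /=; congr (_ * _); ring.
apply/matrixP => k l; rewrite [LHS]mxE projE !Phi1E rmorphM rmorph_nat /=.
rewrite conj_inv_sqrt2 mulrACA sqr_inv_sqrt2 -natrM mulnb !mxE.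
by rewrite eq_sym [j == l]eq_sym.
Qed.

Lemma tblock_choi L i j : tblock (choi_state L) i j = 2^-1 *: L (delta_mx i j).
Proof. by rewrite tblock_id_tens tblock_Phi1 linearZ. Qed.

Lemma trace_delta n (i j : 'I_n) : \tr (delta_mx i j : 'M[C]_n) = (i == j)%:R.
Proof.
rewrite /mxtrace (bigD1 i) //= big1 ?addr0 => [|k ki].
  by rewrite mxE eqxx.
by rewrite mxE (negPf ki).
Qed.

(** Block [(i, j)] is half the image of a matrix unit, whose trace [L] preserves; Alice's marginal
    is thus maximally mixed. *)
Lemma trace_choi_left L (A : 'M[C]_2) : trace_preserving L ->
  \tr (choi_state L *m (A *t 1%:M)) = \tr A / 2.
Proof.
move=> trL; rewrite trace_mul_tens /mxtrace mulr_suml; apply: eq_bigr => i _.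
have trB j : \tr (tblock (choi_state L) i j *m 1%:M) = (i == j)%:R / 2.
  by rewrite mulmx1 tblock_choi mxtraceZ trL trace_delta mulrC.
rewrite -/(mxtrace _).
rewrite (bigD1 i) //= -/(mxtrace _) trB eqxx mul1r big1 ?addr0 // => j ji.
by rewrite -/(mxtrace _) trB eq_sym (negPf ji) mul0r mulr0.
Qed.

(** Bob's marginal is half of [L 1%:M], so unitality can be read off it. *)
Lemma trace_choi_right L (B : 'M[C]_2) :
  \tr (choi_state L *m (1%:M *t B)) = \tr (L 1%:M *m B) / 2.
Proof.
rewrite trace_mul_tens1l /ptrace_left.
have -> : \sum_i tblock (choi_state L) i i = 2^-1 *: L 1%:M.
  have -> : 1%:M = \sum_i delta_mx i i :> 'M[C]_2.
    by rewrite sum_ord2 mx2_1 [RHS]eta_mx2 !mxE /=; congr mx2; ring.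
  by rewrite linear_sum scaler_sumr; apply: eq_bigr => i _; rewrite tblock_choi.
by rewrite -scalemxAl mxtraceZ mulrC.
Qed.

Lemma trace_choi L : trace_preserving L -> \tr (choi_state L) = 1.
Proof.
move=> trL; rewrite -[choi_state L]mulmx1 -tens11 trace_choi_left //.
by rewrite mxtrace1 divff // pnatr_eq0.
Qed.

Lemma psdmx_proj n (v : 'cV[C]_n) : psdmx (Defs.proj v).
Proof.
move=> u; rewrite /Defs.proj mulmxA -mulmxA.
have -> : adjmx v *m u = adjmx (adjmx u *m v) by rewrite adjmxM adjmxK.
have normz (z : 'M[C]_1) : 0 <= (z *m adjmx z) 0 0.
  by have := projE z 0 0; rewrite /Defs.proj => ->; exact: mul_conjC_ge0.
exact: normz.
Qed.

Lemma choi_herm L :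
  completely_positive L -> adjmx (choi_state L) = choi_state L.
Proof. by move=> cpL; apply/psdmx_herm/cpL/psdmx_proj. Qed.

Lemma rank_choi_gt2 L : nonunital_channel L ->
  useful (choi_state L) -> universal (choi_state L) ->
  (2 < \rank (choi_state L))%N.
Proof.
move=> [[cpL trL] nuL] usefulL [rhoC [[U [V [uU uV rhoCE]]] diagC _]].
move/esym/fidelity_stddev_eq0 => eqT.
pose tau := correlation_mx rhoC 0 0.
have corC : forall A B : 'M[C]_2, \tr A = 0 -> \tr B = 0 ->
    \tr (rhoC *m (A *t B)) = tau%:C / 2 * \tr (A *m B).
  apply: correlation_form => i j.
  rewrite correlation_mxE; last first.
    by rewrite rhoCE local_unitary_herm // choi_herm.
  have [<-|ij] := eqVneq i j; first by rewrite (eqT i 0).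
  by rewrite (is_diag_mxP diagC) // ; apply: contraNneq ij => /val_inj ->.
have trJ (W A : 'M[C]_2) : W \is unitarymx -> \tr (W *m A *m adjmx W) = \tr A.
  exact: trace_unitary_conj.
have [tau0|tau0] := eqVneq (tau%:C : C) 0.
  exfalso; apply: uncorrelated_not_useful usefulL; first exact: trace_choi.
  move=> A B trA trB; rewrite (trace_mul_local_unitary _ _ _ uU uV) -rhoCE.
  by rewrite corC ?trJ // tau0 !mul0r.
rewrite -(rank_local_unitary _ uU uV) -rhoCE ltnNge; apply/negP => rk2.
apply: nuL; rewrite /unital; apply/eqP; rewrite -subr_eq0; apply/eqP.
have margC A : \tr (rhoC *m (A *t 1%:M)) = \tr A / 2.
  rewrite rhoCE trace_local_unitary mulmx1 unitary_adj_mul //.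
  rewrite trace_choi_left //.
  congr (_ / _); have := trJ (adjmx U) A (adjmx_unitary uU).
  by rewrite adjmxK.
have bob := rank2_marginal margC corC tau0 rk2.
(* [L 1%:M - 1%:M] is traceless, and its Pauli coordinates are expectations in Bob's marginal;
   rotating by [V] keeps the observables traceless, so [bob] applies. *)
rewrite [LHS]traceless_pauli; last first.
  by rewrite raddfB /= trL subrr.
rewrite big1 // => i _; rewrite mulmxBl mul1mx raddfB /= trace_sigma subr0.
rewrite -trace_choi_right (trace_mul_local_unitary _ _ _ uU uV) -rhoCE.
by rewrite mulmx1 unitary_mul_adj // bob ?scale0r // trJ // trace_sigma.
Qed.

End ChoiState.

(** * Channels replacing their input by a fixed state *)

Section ReplacementChannel.
Variable R : realType.
Local Notation C := R[i].

Lemma trace_tens m n (A : 'M[C]_m) (B : 'M[C]_n) :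
  \tr (A *t B) = \tr A * \tr B.
Proof.
rewrite trace_tblock mulr_suml; apply: eq_bigr => i _.
by rewrite tblock_tens mxtraceZ.
Qed.

Lemma tblock_mul_tens1 m n (A : 'M[C]_(m * n)) (K N : 'M[C]_n) i j :
  tblock ((1%:M *t K) *m A *m (1%:M *t N)) i j = K *m tblock A i j *m N.
Proof.
have one_sum (F : 'I_m -> 'M[C]_n) k :
    \sum_l (1%:M : 'M[C]_m) k l *: F l = F k.
  rewrite (bigD1 k) //= big1 ?addr0 => [|l lk].
    by rewrite mxE eqxx scale1r.
  by rewrite mxE eq_sym (negPf lk) scale0r.
have one_sum' (F : 'I_m -> 'M[C]_n) k :
    \sum_l (1%:M : 'M[C]_m) l k *: F l = F k.
  by rewrite -[RHS]one_sum; apply: eq_bigr => l _; rewrite !mxE eq_sym.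
rewrite tblockM -[RHS](one_sum' (fun l => K *m tblock A i l *m N)).
apply: eq_bigr => l _; rewrite tblock_tens -scalemxAr; congr (_ *: (_ *m _)).
rewrite tblockM -[RHS](one_sum (fun p => K *m tblock A p l)).
by apply: eq_bigr => p _; rewrite tblock_tens -scalemxAl.
Qed.

(* With D a state other than 1/2, this non-unital channel outputs an
   uncorrelated state, and its Choi state 1/2 (x) D has rank 4 when D does
   not degenerate. *)
Definition replacement (D A : 'M[C]_2) : 'M[C]_2 := \tr A *: D.

Fact replacement_is_linear D : linear (replacement D).
Proof. by move=> a A B; rewrite /replacement linearP scalerDl scalerA. Qed.

HB.instance Definition _ (D : 'M[C]_2) :=
  GRing.isLinear.Build C 'M[C]_2 'M[C]_2 _ (replacement D)
    (replacement_is_linear D).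

(** Kraus decomposition with operators [sqrt p |0><l|] and [sqrt q |1><l|]; the weights stay outside
    so that no root is taken. *)
Lemma replacement_cp (p q : C) : 0 <= p -> 0 <= q ->
  completely_positive (replacement (mx2 p 0 0 q)).
Proof.
move=> p0 q0 m A psdA.
pose K k l : 'M[C]_(m * 2) := 1%:M *t delta_mx k l.
have -> : id_tens (replacement (mx2 p 0 0 q)) A =
    \sum_l (p *: (K 0 l *m A *m K l 0) + q *: (K 1 l *m A *m K l 1)).
  apply/tblockP => i j; rewrite tblock_id_tens tblock_sum.
  have tbl l :
      tblock (p *: (K 0 l *m A *m K l 0) + q *: (K 1 l *m A *m K l 1)) i j
      = tblock A i j l l *: mx2 p 0 0 q.
    have ZE (a b : C) (M N : 'M[C]_(m * 2)) : tblock (a *: M + b *: N) i j =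
        a *: tblock M i j + b *: tblock N i j.
      by apply/matrixP => k k'; rewrite !mxE.
    rewrite ZE !tblock_mul_tens1; move: (tblock A i j) => B.
    have dd (k : 'I_2) :
        delta_mx k l *m B *m delta_mx l k = B l l *: delta_mx k k.
      apply/matrixP => a b; rewrite !mxE (bigD1 l) //= big1 ?addr0 => [|c cl].
        rewrite !mxE (bigD1 l) //= big1 ?addr0 => [|c cl].
          by rewrite !mxE !eqxx andbT /= -mulrA mulrC mulrAC -mulrA -natrM
            mulnb.
        by rewrite !mxE (negPf cl) andbF mul0r.
      by rewrite !mxE (negPf cl) mulr0.
    rewrite !dd [LHS]eta_mx2 [RHS]eta_mx2 !mxE /=.
    by congr mx2; ring.
  by rewrite (eq_bigr _ (fun l _ => tbl l)) -scaler_suml.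
move=> v; rewrite mulmx_sumr mulmx_suml summxE; apply: sumr_ge0 => l _.
have formD (a b : C) (M N : 'M[C]_(m * 2)) :
    (adjmx v *m (a *: M + b *: N) *m v) 0 0 =
    a * (adjmx v *m M *m v) 0 0 + b * (adjmx v *m N *m v) 0 0.
  by rewrite mulmxDr mulmxDl -!scalemxAr -!scalemxAl; do 2 move: (_ *m v) => ?;
     rewrite !mxE.
rewrite formD.
(* [K l k] is the adjoint of [K k l], so this is the form of [A] at [K l k *m v]. *)
have pos k : 0 <= (adjmx v *m (K k l *m A *m K l k) *m v) 0 0.
  have := psdA (K l k *m v).
  by rewrite adjmxM adjmx_tens adjmx1 adjmx_delta !mulmxA.
by rewrite addr_ge0 // mulr_ge0 ?pos.
Qed.

Lemma choi_replacement D : choi_state (replacement D) = 1%:M *t (2^-1 *: D).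
Proof.
apply/tblockP => i j; rewrite tblock_choi tblock_tens mxE.
rewrite -[LHS]/(2^-1 *: (\tr (delta_mx i j) *: D)).
by rewrite trace_delta !scalerA mulrC.
Qed.

End ReplacementChannel.

Theorem proposition6 (R : realType) :
  [set L : {linear 'M[R[i]]_2 -> 'M[R[i]]_2} |
     [/\ nonunital_channel L, useful (choi_state L) & universal (choi_state L)]]
  `<`
  [set L : {linear 'M[R[i]]_2 -> 'M[R[i]]_2} |
     nonunital_channel L /\
     (\rank (choi_state L) = 3%N \/ \rank (choi_state L) = 4%N)].
Proof.
split=> [L /= [nuL usefulL univL]|sub].
  split=> //; have := rank_choi_gt2 nuL usefulL univL.
  have : (\rank (choi_state L) <= 4)%N by exact: rank_leq_row.
  by move: (\rank _) => [|[|[|[|[|r]]]]] // _ _; [left | right].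
(* The eigenvalues sum to 1, are distinct so that the channel is non-unital, and are nonzero so that
   the Choi state is invertible. *)
pose D : 'M[R[i]]_2 := mx2 (3 / 4) 0 0 4^-1.
have trD : \tr D = 1 by rewrite /mxtrace sum_ord2 !mx2E; field.
have trL : trace_preserving (replacement D).
  by move=> A; rewrite mxtraceZ trD mulr1.
have nuL : nonunital_channel (replacement D).
  split; first split=> //.
    by apply: replacement_cp; rewrite ?divr_ge0 ?invr_ge0 ?ler0n.
  rewrite /unital /= /replacement mxtrace1 => /matrixP/(_ 0 0).
  rewrite !mxE /= => /eqP; rewrite -subr_eq0.
  have -> : 2%:R * (3 / 4) - 1%:R = 2^-1 :> R[i] by field.
  by rewrite invr_eq0 pnatr_eq0.
have rk : \rank (choi_state (replacement D)) = 4%N.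
  rewrite choi_replacement mxrank_unit // tensmx_unit ?unitmx1 //.
  have : (2^-1 *: D) *m mx2 (8 / 3) 0 0 8 = 1%:M.
    rewrite mx2_1 [LHS]eta_mx2 !mxE !sum_ord2 !mxE /=.
    by congr mx2; field.
  by case/mulmx1_unit.
(* [sub] is the reverse inclusion, to be refuted for strictness. *)
have [_ usefulL _] : [/\ nonunital_channel (replacement D),
    useful (choi_state (replacement D)) &
    universal (choi_state (replacement D))].
  by apply: (sub (replacement D)); split=> //; right.
(* The Choi state is a product with identity first factor, so the trace has the vanishing factor
   [\tr A]. *)
apply: uncorrelated_not_useful usefulL; first exact: trace_choi.
move=> A B trA trB; rewrite choi_replacement tensmx_mul mul1mx.
by rewrite trace_tens trA mul0r.
Qed.
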